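(* Let $\mathcal{M}=(\mathbb{R}^+\times\mathbb{R},\nabla)$ be a Type $\mathcal{B}$ surface model with $\dim\{\mathfrak{K}(\mathcal{M})\}=2$. Then $\mathcal{M}$ is strongly projectively flat if and only if it is linearly isomorphic to a surface given by $$C_{11}{}^1=1+2c,\quad C_{11}{}^2=0,\quad C_{12}{}^1=0,\quad C_{12}{}^2=c,\quad C_{22}{}^1=\pm1,\quad C_{22}{}^2=0,$$ for some real $c\notin\{-1,0\}$ and some choice of sign $\pm$. For such a surface $$\rho=(x^1)^{-2}\{c(2+c)\,dx^1\otimes dx^1\pm c\,dx^2\otimes dx^2\},$$ and moreover $E(0,\nabla)=\operatorname{Span}\{1\}$, $E(-1,\nabla)=(x^1)^c\operatorname{Span}\{1,\ x^2,\ (x^1)^2\pm(x^2)^2\}$ (with the same sign as in $C_{22}{}^1=\pm1$), and $E(\mu,\nabla)=\{0\}$ for all real $\mu\notin\{0,-1\}$.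
   Context: For a torsion free connection $\nabla$ on a surface, with $\nabla_{\partial_{x^i}}\partial_{x^j}=\Gamma_{ij}{}^k\partial_{x^k}$, put $R(X,Y)=[\nabla_X,\nabla_Y]-\nabla_{[X,Y]}$, $\rho(X,Y)=\operatorname{Tr}\{Z\mapsto R(Z,X)Y\}$, and let $\rho_s$ be the symmetrization of $\rho$. The Hessian is $\mathcal{H}f=(\partial_{x^i}\partial_{x^j}f-\Gamma_{ij}{}^k\partial_{x^k}f)\,dx^i\otimes dx^j$, and for $\mu\in\mathbb{R}$, $E(\mu,\nabla)=\{f\in C^\infty: \mathcal{H}f=\mu f\rho_s\}$. $\mathfrak{K}(\mathcal{M})$ is the Lie algebra of affine Killing vector fields, i.e. vector fields $X$ with $\mathcal{L}_X\nabla=0$. $\nabla$ is strongly projectively flat if it is strongly projectively equivalent to a flat connection, i.e. locally $\nabla_XY=\nabla^0_XY+\omega(X)Y+\omega(Y)X$ with $\nabla^0$ flat torsion free and $\omega$ a closed 1-form; for surfaces this is equivalent to $\rho$ and $\nabla\rho$ being totally symmetric. A Type $\mathcal{B}$ surface model is $\mathbb{R}^+\times\mathbb{R}$ (coordinates $x^1>0$, $x^2$) with Christoffel symbols $\Gamma_{ij}{}^k=(x^1)^{-1}C_{ij}{}^k$, $C_{ij}{}^k=C_{ji}{}^k$ real constants. Two such models are linearly isomorphic if some map $(x^1,x^2)\mapsto(x^1,a\,x^1+b\,x^2)$ with $b\neq0$ intertwines the connections. The notation $g\operatorname{Span}\{h_1,\dots\}$ means $\operatorname{Span}\{gh_1,\dots\}$.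 *)

(* Defs.v *)
From Stdlib Require Import Reals List.
From Coquelicot Require Import Coquelicot.

Open Scope R_scope.

(* Functions, vector fields, 1-forms and connections on an open subset [U] of
   the plane are represented by total functions of the coordinates (x^1, x^2);
   their values outside [U] are irrelevant, so equality of two such objects
   always means equality at the points of [U]. *)

Inductive idx := I1 | I2.

Definition sum_idx (F : idx -> R) : R := F I1 + F I2.

Definition delta (i j : idx) : R :=
  match i, j with
  | I1, I1 | I2, I2 => 1
  | _, _ => 0
  end.

Definition region := R * R -> Prop.
Definition sfun := R -> R -> R.
Definition vfield := idx -> sfun.
Definition oneform := idx -> sfun.

(* [Gamma i j k] is the Christoffel symbol Gamma_{ij}^k. *)
Definition christoffel := idx -> idx -> idx -> sfun.

Definition half_plane : region := fun p => 0 < fst p.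

Definition pd (i : idx) (f : sfun) : sfun := fun x y =>
  match i with
  | I1 => Derive (fun t => f t y) x
  | I2 => Derive (fun t => f x t) y
  end.

(* For an open [U] this is C^infinity on [U]: all iterated partial derivatives
   exist and are continuous. *)
Definition smooth (U : region) (f : sfun) : Prop :=
  forall x y, U (x, y) -> forall n, ex_diff_n f n x y.

Definition smooth_vfield (U : region) (X : vfield) : Prop :=
  forall k, smooth U (X k).

Definition smooth_christoffel (U : region) (Gamma : christoffel) : Prop :=
  forall i j k, smooth U (Gamma i j k).

Definition eq_vfield (U : region) (X Y : vfield) : Prop :=
  forall x y, U (x, y) -> forall k, X k x y = Y k x y.

Definition frame (i : idx) : vfield := fun k _ _ => delta i k.

Definition vadd (X Y : vfield) : vfield := fun k x y => X k x y + Y k x y.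
Definition vsub (X Y : vfield) : vfield := fun k x y => X k x y - Y k x y.
Definition vscale (f : sfun) (X : vfield) : vfield :=
  fun k x y => f x y * X k x y.

Definition bracket (X Y : vfield) : vfield := fun k x y =>
  sum_idx (fun i => X i x y * pd i (Y k) x y - Y i x y * pd i (X k) x y).

Definition nabla (Gamma : christoffel) (X Y : vfield) : vfield := fun k x y =>
  sum_idx (fun i => X i x y *
    (pd i (Y k) x y + sum_idx (fun j => Gamma i j k x y * Y j x y))).

Definition torsion_free (U : region) (Gamma : christoffel) : Prop :=
  forall i j k x y, U (x, y) -> Gamma i j k x y = Gamma j i k x y.

(* R(X,Y) Z, with R(X,Y) = [nabla_X, nabla_Y] - nabla_[X,Y] *)
Definition curvature (Gamma : christoffel) (X Y Z : vfield) : vfield :=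
  vsub (vsub (nabla Gamma X (nabla Gamma Y Z)) (nabla Gamma Y (nabla Gamma X Z)))
       (nabla Gamma (bracket X Y) Z).

(* rho(X,Y) = Tr (Z |-> R(Z,X) Y), the trace being taken in the coordinate
   frame *)
Definition ricci (Gamma : christoffel) (X Y : vfield) : sfun := fun x y =>
  sum_idx (fun i => curvature Gamma (frame i) X Y i x y).

Definition ricci_sym (Gamma : christoffel) (X Y : vfield) : sfun := fun x y =>
  (ricci Gamma X Y x y + ricci Gamma Y X x y) / 2.

Definition hessian (Gamma : christoffel) (f : sfun) (i j : idx) : sfun :=
  fun x y => pd i (pd j f) x y - sum_idx (fun k => Gamma i j k x y * pd k f x y).

(* [E U mu Gamma f] : f belongs to E(mu, nabla) on U *)
Definition E (U : region) (mu : R) (Gamma : christoffel) (f : sfun) : Prop :=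
  smooth U f /\
  forall i j x y, U (x, y) ->
    hessian Gamma f i j x y =
      mu * f x y * ricci_sym Gamma (frame i) (frame j) x y.

(* (L_X nabla)(Y,Z) = [X, nabla_Y Z] - nabla_[X,Y] Z - nabla_Y [X,Z] *)
Definition lie_connection (Gamma : christoffel) (X Y Z : vfield) : vfield :=
  vsub (vsub (bracket X (nabla Gamma Y Z)) (nabla Gamma (bracket X Y) Z))
       (nabla Gamma Y (bracket X Z)).

Definition affine_killing (U : region) (Gamma : christoffel) (X : vfield) : Prop :=
  smooth_vfield U X /\
  forall Y Z, smooth_vfield U Y -> smooth_vfield U Z ->
    eq_vfield U (lie_connection Gamma X Y Z) (fun _ _ _ => 0).

Definition lincomb (n : nat) (a : nat -> R) (B : nat -> vfield) : vfield :=
  fun k x y => fold_right Rplus 0 (map (fun m => a m * B m k x y) (seq 0 n)).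

(* The space [V] of vector fields on [U] has a basis of [n] elements. *)
Definition has_dim (U : region) (V : vfield -> Prop) (n : nat) : Prop :=
  exists B : nat -> vfield,
    (forall m, (m < n)%nat -> V (B m)) /\
    (forall a, eq_vfield U (lincomb n a B) (fun _ _ _ => 0) ->
       forall m, (m < n)%nat -> a m = 0) /\
    (forall X, V X -> exists a, eq_vfield U X (lincomb n a B)).

Definition flat (U : region) (Gamma : christoffel) : Prop :=
  forall X Y Z, smooth_vfield U X -> smooth_vfield U Y -> smooth_vfield U Z ->
    eq_vfield U (curvature Gamma X Y Z) (fun _ _ _ => 0).

Definition closed_oneform (U : region) (w : oneform) : Prop :=
  (forall i, smooth U (w i)) /\
  forall x y, U (x, y) -> pd I1 (w I2) x y = pd I2 (w I1) x y.

Definition pairing (w : oneform) (X : vfield) : sfun := fun x y =>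
  sum_idx (fun i => w i x y * X i x y).

(* nabla_X Y = nabla0_X Y + w(X) Y + w(Y) X on [U] *)
Definition proj_related (U : region) (Gamma Gamma0 : christoffel) (w : oneform)
  : Prop :=
  forall X Y, smooth_vfield U X -> smooth_vfield U Y ->
    eq_vfield U (nabla Gamma X Y)
      (vadd (nabla Gamma0 X Y)
            (vadd (vscale (pairing w X) Y) (vscale (pairing w Y) X))).

Definition strongly_proj_flat (U : region) (Gamma : christoffel) : Prop :=
  forall p, U p -> exists (V : region) (Gamma0 : christoffel) (w : oneform),
    open V /\ V p /\ (forall q, V q -> U q) /\
    smooth_christoffel V Gamma0 /\ torsion_free V Gamma0 /\ flat V Gamma0 /\
    closed_oneform V w /\ proj_related V Gamma Gamma0 w.

Definition typeB (C : idx -> idx -> idx -> R) : christoffel :=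
  fun i j k x _ => / x * C i j k.

(* Push-forward of a vector field along (x, y) |-> (x, a x + b y), b <> 0;
   the inverse map is (x, u) |-> (x, (u - a x) / b). *)
Definition push (a b : R) (X : vfield) : vfield := fun k x u =>
  let y := (u - a * x) / b in
  match k with
  | I1 => X I1 x y
  | I2 => a * X I1 x y + b * X I2 x y
  end.

Definition linearly_isomorphic (Gamma Gamma' : christoffel) : Prop :=
  exists a b, b <> 0 /\
    forall X Y, smooth_vfield half_plane X -> smooth_vfield half_plane Y ->
      eq_vfield half_plane
        (push a b (nabla Gamma X Y)) (nabla Gamma' (push a b X) (push a b Y)).

(* e is the sign: C_11^1 = 1+2c, C_12^2 = C_21^2 = c, C_22^1 = e, others 0 *)
Definition modelC (c e : R) (i j k : idx) : R :=
  match i, j, k with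
  | I1, I1, I1 => 1 + 2 * c
  | I1, I2, I2 | I2, I1, I2 => c
  | I2, I2, I1 => e
  | _, _, _ => 0
  end.

(* Main.v *)
Require Import Defs.
From Stdlib Require Import Reals.
From Coquelicot Require Import Coquelicot.
From Stdlib Require Import Lra List FunctionalExtensionality.

(** Write C for the constants of a type B model. If the model is Gamma0 + w with
    Gamma0 flat and w closed, the vanishing of the Ricci tensor of Gamma0 prescribes
    all first derivatives of w:
      d_i w_j = C_ij^k w_k / x - rho_ij - w_i w_j    ([ricci_flat_oneform]).
    Equality of mixed second derivatives of w then forces rho and nabla rho to be
    symmetric ([strongly_proj_flat_codazzi]); since x only enters through powers,
    these are polynomial equations in C.

    They are solved by distinguishing C_22^1 = 0 from C_22^1 <> 0. In the first case
    only C_11^1, C_11^2 and C_12^2 survive, and some field g(x) d_2 is affine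
    Killing. Every type B model also admits the Killing fields d_2 and
    x d_1 + y d_2, so dimension two excludes this case ([dim2_C221_neq0]). In the
    second case a shear y + s x kills C_12^1, the equations leave one parameter m,
    and a rescaling of y makes C_22^1 = 1 or -1: this is the normal form of the
    statement ([codazzi_normal_form], [conjugate_normal_form]). For m = 0 the model
    is flat and for m = -1 it is the Levi-Civita connection of a metric of constant
    curvature; both have a third Killing field, which excludes these values
    ([dim2_spf_isomorphic]). Conversely w = d (c log x) flattens every model in
    normal form ([conjugate_model_spf]).

    The spaces E(mu) of the normal form are found by integrating an overdetermined
    system. The derivative h = d_2 f satisfies d_1 h = (c/x) h and
    d_2^2 h = e c (1 + mu) x^-2 h, which are incompatible unless h = 0 or mu = -1.
    If h = 0, then f solves a first-order equation in x which leaves the constants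
    for mu = 0 and nothing for other mu <> -1 ([E_model_zero], [E_model_other]).
    If mu = -1, division by x^c turns f into an affine function of the flat
    connection Gamma0, and these are spanned by 1, y and x^2 + e y^2
    ([E_model_minus_one]). *)

Open Scope R_scope.

(** * Smooth functions and partial derivatives *)

Lemma open_locally_2d (U : region) (P : R -> R -> Prop) x y :
  open U -> U (x, y) -> (forall u v, U (u, v) -> P u v) -> locally_2d P x y.
Proof.
  intros oU Uxy H. apply locally_2d_locally.
  generalize (oU (x, y) Uxy). apply filter_imp.
  intros [u v] Huv. exact (H u v Huv).
Qed.

Lemma open_half_plane : open half_plane.
Proof.
  unfold half_plane. apply (open_comp fst (fun x => 0 < x)).
  - intros p _. apply (@continuous_fst R_UniformSpace R_UniformSpace).
  - apply open_gt.
Qed.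

(** A coinductive reading of smoothness, which lets closure properties be
    proved by an invariant: a class of differentiable functions that is stable
    on [U] under both partial derivatives consists of smooth functions. *)
Lemma smooth_coind (U : region) (P : sfun -> Prop) :
  open U ->
  (forall f, P f -> forall x y, U (x, y) ->
     continuity_2d_pt f x y /\ ex_derive (fun t => f t y) x /\
     ex_derive (fun t => f x t) y) ->
  (forall f i, P f ->
     exists g, P g /\ forall x y, U (x, y) -> g x y = pd i f x y) ->
  forall f, P f -> smooth U f.
Proof.
  intros oU H1 H2 f Hf x y Uxy n. revert f Hf x y Uxy.
  induction n as [|n IH]; intros f Hf x y Uxy;
    destruct (H1 f Hf x y Uxy) as (C & D1 & D2).
  - split; [exact C | exact I].
  - split; [exact C|]. split; [exact D1|]. split; [exact D2|].
    split; [destruct (H2 f I1 Hf) as (g & Pg & Eg)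
           |destruct (H2 f I2 Hf) as (g & Pg & Eg)];
      refine (ex_diff_n_ext_loc _ _ _ _ _ (open_locally_2d U _ x y oU Uxy Eg) _);
      exact (IH g Pg x y Uxy).
Qed.

Lemma smooth_pd U f i : smooth U f -> smooth U (pd i f).
Proof.
  intros Hf x y Uxy n. destruct (Hf x y Uxy (S n)) as (_ & _ & _ & H1 & H2).
  destruct i; assumption.
Qed.

Lemma smooth_continuity U f x y : smooth U f -> U (x, y) -> continuity_2d_pt f x y.
Proof. intros Hf Uxy. exact (proj1 (Hf x y Uxy 0%nat)). Qed.

Lemma smooth_derive1 U f x y :
  smooth U f -> U (x, y) -> ex_derive (fun t => f t y) x.
Proof. intros Hf Uxy. exact (proj1 (proj2 (Hf x y Uxy 1%nat))). Qed.

Lemma smooth_derive2 U f x y :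
  smooth U f -> U (x, y) -> ex_derive (fun t => f x t) y.
Proof. intros Hf Uxy. exact (proj1 (proj2 (proj2 (Hf x y Uxy 1%nat)))). Qed.

Lemma smooth_ext U f g :
  open U -> (forall x y, U (x, y) -> f x y = g x y) -> smooth U f -> smooth U g.
Proof.
  intros oU H Hf x y Uxy n. apply ex_diff_n_ext_loc with f; [|exact (Hf x y Uxy n)].
  exact (open_locally_2d U _ x y oU Uxy H).
Qed.

Lemma pd_ext U f g i x y :
  open U -> U (x, y) -> (forall u v, U (u, v) -> f u v = g u v) ->
  pd i f x y = pd i g x y.
Proof.
  intros oU Uxy H.
  assert (L := open_locally_2d U (fun u v => f u v = g u v) x y oU Uxy H).
  destruct i; simpl; apply Derive_ext_loc.
  - exact (locally_2d_1d_const_y _ _ _ L).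
  - exact (locally_2d_1d_const_x _ _ _ L).
Qed.

Lemma smooth_of_pd U f g1 g2 : open U ->
  (forall x y, U (x, y) -> continuity_2d_pt f x y) ->
  (forall x y, U (x, y) -> is_derive (fun t => f t y) x (g1 x y)) ->
  (forall x y, U (x, y) -> is_derive (fun t => f x t) y (g2 x y)) ->
  smooth U g1 -> smooth U g2 -> smooth U f.
Proof.
  intros oU C D1 D2 G1 G2.
  apply (smooth_coind U (fun h => h = f \/ smooth U h) oU); [| |left; reflexivity].
  - intros h [-> | Hh] x y Uxy.
    + split; [exact (C x y Uxy)|].
      split; [exists (g1 x y); auto | exists (g2 x y); auto].
    + split; [|split].
      * exact (smooth_continuity U h x y Hh Uxy).
      * exact (smooth_derive1 U h x y Hh Uxy).
      * exact (smooth_derive2 U h x y Hh Uxy).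
  - intros h i [-> | Hh].
    + destruct i; [exists g1 | exists g2]; (split; [right; assumption|]);
        intros x y Uxy; symmetry; apply is_derive_unique; auto.
    + exists (pd i h). split; [right; exact (smooth_pd U h i Hh) | reflexivity].
Qed.

Lemma pd_const c i x y : pd i (fun _ _ => c) x y = 0.
Proof. destruct i; [exact (Derive_const c x) | exact (Derive_const c y)]. Qed.

Lemma smooth_const U c : open U -> smooth U (fun _ _ => c).
Proof.
  intro oU.
  apply (smooth_coind U (fun f => exists c, f = fun _ _ => c) oU).
  - intros f [d ->] x y _. split; [apply continuity_2d_pt_const|].
    split; apply @ex_derive_const.
  - intros f i [d ->]. exists (fun _ _ => 0). split; [exists 0; reflexivity|].
    intros x y _. symmetry. apply pd_const.
  - exists c. reflexivity.
Qed.

Lemma pd_plus U f g i x y : smooth U f -> smooth U g -> U (x, y) ->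
  pd i (fun u v => f u v + g u v) x y = pd i f x y + pd i g x y.
Proof.
  intros Hf Hg Uxy. destruct i; simpl.
  - apply (Derive_plus (fun t => f t y) (fun t => g t y)); eapply smooth_derive1; eauto.
  - apply (Derive_plus (fun t => f x t) (fun t => g x t)); eapply smooth_derive2; eauto.
Qed.

Lemma pd_minus U f g i x y : smooth U f -> smooth U g -> U (x, y) ->
  pd i (fun u v => f u v - g u v) x y = pd i f x y - pd i g x y.
Proof.
  intros Hf Hg Uxy. destruct i; simpl.
  - apply (Derive_minus (fun t => f t y) (fun t => g t y)); eapply smooth_derive1; eauto.
  - apply (Derive_minus (fun t => f x t) (fun t => g x t)); eapply smooth_derive2; eauto.
Qed.

Lemma pd_mult U f g i x y : smooth U f -> smooth U g -> U (x, y) ->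
  pd i (fun u v => f u v * g u v) x y = pd i f x y * g x y + f x y * pd i g x y.
Proof.
  intros Hf Hg Uxy. destruct i; simpl.
  - apply (Derive_mult (fun t => f t y) (fun t => g t y)); eapply smooth_derive1; eauto.
  - apply (Derive_mult (fun t => f x t) (fun t => g x t)); eapply smooth_derive2; eauto.
Qed.

(** The derivative of a product is not a product but a sum of products, so the
    invariant that proves sums and products smooth is the whole algebra. *)
Inductive smooth_algebra (U : region) : sfun -> Prop :=
| alg_smooth f : smooth U f -> smooth_algebra U f
| alg_plus f g : smooth_algebra U f -> smooth_algebra U g ->
    smooth_algebra U (fun x y => f x y + g x y)
| alg_mult f g : smooth_algebra U f -> smooth_algebra U g ->
    smooth_algebra U (fun x y => f x y * g x y).

Lemma smooth_algebra_smooth U f : open U -> smooth_algebra U f -> smooth U f.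
Proof.
  intros oU.
  assert (D : forall f, smooth_algebra U f -> forall x y, U (x, y) ->
     continuity_2d_pt f x y /\ ex_derive (fun t => f t y) x /\
     ex_derive (fun t => f x t) y).
  { intros h Hh x y Uxy.
    induction Hh as [h Hh | f1 f2 _ (C1 & A1 & B1) _ (C2 & A2 & B2)
                          | f1 f2 _ (C1 & A1 & B1) _ (C2 & A2 & B2)].
    - split; [|split].
      + exact (smooth_continuity U h x y Hh Uxy).
      + exact (smooth_derive1 U h x y Hh Uxy).
      + exact (smooth_derive2 U h x y Hh Uxy).
    - split; [exact (continuity_2d_pt_plus _ _ _ _ C1 C2)|].
      split; [exact (ex_derive_plus _ _ _ A1 A2) | exact (ex_derive_plus _ _ _ B1 B2)].
    - split; [exact (continuity_2d_pt_mult _ _ _ _ C1 C2)|].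
      split; [exact (ex_derive_mult _ _ _ A1 A2) | exact (ex_derive_mult _ _ _ B1 B2)]. }
  apply (smooth_coind U (smooth_algebra U) oU D).
  intros h i Hh.
  induction Hh as [h Hh | f1 f2 P1 (g1 & Q1 & E1) P2 (g2 & Q2 & E2)
                        | f1 f2 P1 (g1 & Q1 & E1) P2 (g2 & Q2 & E2)].
  - exists (pd i h). split; [apply alg_smooth, smooth_pd, Hh | reflexivity].
  - exists (fun x y => g1 x y + g2 x y). split; [exact (alg_plus U _ _ Q1 Q2)|].
    intros x y Uxy. rewrite E1, E2 by exact Uxy.
    destruct (D f1 P1 x y Uxy) as (_ & A1 & B1).
    destruct (D f2 P2 x y Uxy) as (_ & A2 & B2).
    destruct i; symmetry; [exact (Derive_plus _ _ _ A1 A2)|exact (Derive_plus _ _ _ B1 B2)].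
  - exists (fun x y => g1 x y * f2 x y + f1 x y * g2 x y).
    split; [apply alg_plus; apply alg_mult; assumption|].
    intros x y Uxy. rewrite E1, E2 by exact Uxy.
    destruct (D f1 P1 x y Uxy) as (_ & A1 & B1).
    destruct (D f2 P2 x y Uxy) as (_ & A2 & B2).
    destruct i; symmetry; [exact (Derive_mult _ _ _ A1 A2)|exact (Derive_mult _ _ _ B1 B2)].
Qed.

Lemma smooth_plus U f g : open U -> smooth U f -> smooth U g ->
  smooth U (fun x y => f x y + g x y).
Proof.
  intros oU Hf Hg. apply smooth_algebra_smooth; [exact oU|].
  apply alg_plus; apply alg_smooth; assumption.
Qed.

Lemma smooth_mult U f g : open U -> smooth U f -> smooth U g ->
  smooth U (fun x y => f x y * g x y).
Proof.
  intros oU Hf Hg. apply smooth_algebra_smooth; [exact oU|].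
  apply alg_mult; apply alg_smooth; assumption.
Qed.

Lemma smooth_minus U f g : open U -> smooth U f -> smooth U g ->
  smooth U (fun x y => f x y - g x y).
Proof.
  intros oU Hf Hg.
  apply (smooth_ext U (fun x y => f x y + -1 * g x y)); [exact oU | intros; ring|].
  apply smooth_plus; [exact oU | exact Hf|].
  apply (smooth_mult U (fun _ _ => -1)); [exact oU | apply smooth_const, oU | exact Hg].
Qed.

Lemma smooth_x_of_derive U (g g' : R -> R) : open U ->
  (forall x y, U (x, y) -> is_derive g x (g' x)) ->
  smooth U (fun x _ => g' x) -> smooth U (fun x _ => g x).
Proof.
  intros oU D Hg'.
  apply (smooth_of_pd U _ (fun x _ => g' x) (fun _ _ => 0) oU).
  - intros x y Uxy. apply (continuity_1d_2d_pt_comp g (fun u _ => u)).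
    + apply derivable_continuous_pt. exists (g' x). apply is_derive_Reals. exact (D x y Uxy).
    + apply continuity_2d_pt_id1.
  - exact D.
  - intros x y _. apply @is_derive_const.
  - exact Hg'.
  - exact (smooth_const U 0 oU).
Qed.

Lemma smooth_x U : open U -> smooth U (fun x _ => x).
Proof.
  intro oU. apply (smooth_x_of_derive U (fun x => x) (fun _ => 1) oU).
  - intros x y _. apply @is_derive_id.
  - exact (smooth_const U 1 oU).
Qed.

Lemma smooth_y U : open U -> smooth U (fun _ y => y).
Proof.
  intro oU. apply (smooth_of_pd U _ (fun _ _ => 0) (fun _ _ => 1) oU).
  - intros. apply continuity_2d_pt_id2.
  - intros. apply @is_derive_const.
  - intros. apply @is_derive_id.
  - exact (smooth_const U 0 oU).
  - exact (smooth_const U 1 oU).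
Qed.

Lemma pd_x i x y : pd i (fun x _ => x) x y = delta I1 i.
Proof. destruct i; [exact (Derive_id x) | exact (Derive_const x y)]. Qed.

Lemma pd_y i x y : pd i (fun _ y => y) x y = delta I2 i.
Proof. destruct i; [exact (Derive_const y x) | exact (Derive_id y)]. Qed.

Lemma pd_comm U f x y : open U -> smooth U f -> U (x, y) ->
  pd I2 (pd I1 f) x y = pd I1 (pd I2 f) x y.
Proof.
  intros oU Hf Uxy. symmetry. unfold pd. apply Schwarz.
  - apply (open_locally_2d U); try assumption. intros u v Huv.
    assert (F1 := smooth_pd U f I1 Hf). assert (F2 := smooth_pd U f I2 Hf).
    split; [|split; [|split]].
    + exact (smooth_derive1 U f u v Hf Huv).
    + exact (smooth_derive2 U f u v Hf Huv).
    + exact (smooth_derive1 U _ u v F2 Huv).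
    + exact (smooth_derive2 U _ u v F1 Huv).
  - exact (smooth_continuity U _ x y (smooth_pd U _ I1 (smooth_pd U f I2 Hf)) Uxy).
  - exact (smooth_continuity U _ x y (smooth_pd U _ I2 (smooth_pd U f I1 Hf)) Uxy).
Qed.

(** Total differentiability, which existence of partial derivatives alone would not
    give, is what the chain rule for [push] rests on. *)
Lemma smooth_differentiable U f x y : open U -> smooth U f -> U (x, y) ->
  differentiable_pt_lim f x y (pd I1 f x y) (pd I2 f x y).
Proof.
  intros oU Hf Uxy. apply filterdiff_differentiable_pt_lim.
  apply (is_derive_filterdiff f x y (pd I1 f) (pd I2 f x y)).
  - generalize (oU (x, y) Uxy). apply filter_imp. intros [u v] Huv.
    apply Derive_correct. exact (smooth_derive1 U f u v Hf Huv).
  - apply Derive_correct. exact (smooth_derive2 U f x y Hf Uxy).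
  - apply continuity_2d_pt_filterlim.
    exact (smooth_continuity U _ x y (smooth_pd U f I1 Hf) Uxy).
Qed.

Lemma is_derive_Rpower x s : 0 < x ->
  is_derive (fun t => Rpower t s) x (s * Rpower x (s - 1)).
Proof. intro Hx. apply is_derive_Reals, derivable_pt_lim_power, Hx. Qed.

(** Powers of x with real exponent are stable under derivation up to constant
    factors, hence the invariant. *)
Lemma smooth_Rpower s : smooth half_plane (fun x _ => Rpower x s).
Proof.
  apply (smooth_coind half_plane
           (fun f => exists k s, f = fun x _ => k * Rpower x s) open_half_plane).
  - intros f (k & r & ->) x y Hx. unfold half_plane in Hx; simpl in Hx.
    assert (D : is_derive (fun t => k * Rpower t r) x (k * (r * Rpower x (r - 1)))).
    { apply is_derive_scal, is_derive_Rpower, Hx. }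
    split; [|split].
    + apply (continuity_1d_2d_pt_comp (fun t => k * Rpower t r) (fun u _ => u)).
      * apply derivable_continuous_pt. eexists. apply is_derive_Reals, D.
      * apply continuity_2d_pt_id1.
    + eexists. exact D.
    + apply @ex_derive_const.
  - intros f i (k & r & ->). destruct i.
    + exists (fun x _ => (k * r) * Rpower x (r - 1)). split; [eauto|].
      intros x y Hx. symmetry. apply is_derive_unique.
      replace (k * r * Rpower x (r - 1)) with (k * (r * Rpower x (r - 1))) by ring.
      apply is_derive_scal, is_derive_Rpower, Hx.
    + exists (fun x _ => 0 * Rpower x 0). split; [eauto|].
      intros x y _. rewrite Rmult_0_l. symmetry. exact (Derive_const _ y).
  - exists 1, s. apply functional_extensionality; intro x.
    apply functional_extensionality; intro y. ring.
Qed.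

Lemma pd_Rpower s i x y : 0 < x ->
  pd i (fun x _ => Rpower x s) x y = delta I1 i * (s * / x * Rpower x s).
Proof.
  intro Hx. destruct i.
  - transitivity (s * Rpower x (s - 1)).
    + exact (is_derive_unique _ _ _ (is_derive_Rpower x s Hx)).
    + unfold Rminus. rewrite Rpower_plus, Rpower_Ropp, Rpower_1 by exact Hx. simpl. ring.
  - transitivity 0; [exact (Derive_const _ y) | simpl; ring].
Qed.

Lemma smooth_inv : smooth half_plane (fun x _ => / x).
Proof.
  apply (smooth_ext half_plane (fun x _ => Rpower x (- (1)))).
  - exact open_half_plane.
  - intros x y Hx. rewrite Rpower_Ropp, Rpower_1 by exact Hx. reflexivity.
  - apply smooth_Rpower.
Qed.

Lemma pd_inv i x y : 0 < x -> pd i (fun x _ => / x) x y = - delta I1 i * (/ x * / x).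
Proof.
  intro Hx. destruct i.
  - simpl. rewrite Derive_inv by (try apply ex_derive_id; lra). rewrite Derive_id. field. lra.
  - transitivity 0; [exact (Derive_const _ y) | simpl; ring].
Qed.

Lemma smooth_ln : smooth half_plane (fun x _ => ln x).
Proof.
  apply (smooth_x_of_derive half_plane ln Rinv open_half_plane); [|apply smooth_inv].
  intros x y Hx. exact (is_derive_ln x Hx).
Qed.

(** Any point is joined to (1, 0) by a vertical and a horizontal segment inside the
    half plane. *)
Lemma smooth_half_plane_const (f : sfun) : smooth half_plane f ->
  (forall i x y, 0 < x -> pd i f x y = 0) ->
  exists a, forall x y, 0 < x -> f x y = a.
Proof.
  intros Hf H. exists (f 1 0). intros x y Hx.
  assert (D1 : forall t, 0 < t -> forall v, is_derive (fun t => f t v) t 0).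
  { intros t Ht v. rewrite <- (H I1 t v Ht). apply Derive_correct.
    exact (smooth_derive1 half_plane f t v Hf Ht). }
  assert (D2 : forall t, 0 < t -> forall v, is_derive (fun v => f t v) v 0).
  { intros t Ht v. rewrite <- (H I2 t v Ht). apply Derive_correct.
    exact (smooth_derive2 half_plane f t v Hf Ht). }
  transitivity (f x 0).
  - destruct (Rtotal_order y 0) as [L | [-> | L]]; [|reflexivity|symmetry];
      apply (eq_is_derive (fun v => f x v)); try exact L; intros; apply D2, Hx.
  - destruct (Rtotal_order x 1) as [L | [-> | L]]; [|reflexivity|symmetry];
      apply (eq_is_derive (fun t => f t 0)); try exact L; intros; apply D1; lra.
Qed.

(** * Tensors of a connection in coordinates *)

Ltac smoothness :=
  repeat first
    [ assumption
    | apply smooth_const | apply smooth_x | apply smooth_y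
    | apply smooth_inv | apply smooth_Rpower | apply smooth_ln
    | apply smooth_minus | apply smooth_plus | apply smooth_mult | apply smooth_pd
    | exact open_half_plane
    | match goal with H : smooth_vfield ?U ?X |- smooth ?U (?X _) => exact (H _) end
    | match goal with
      | H : smooth_christoffel ?U ?G |- smooth ?U (?G _ _ _) => exact (H _ _ _)
      end ].

(** This equation and the next unfold one chosen occurrence of an operator, where
    [unfold] would also open the nested ones that [pd_nabla] and [pd_bracket]
    are to rewrite. *)
Lemma nabla_eq G X Y k x y : nabla G X Y k x y =
  sum_idx (fun i => X i x y *
    (pd i (Y k) x y + sum_idx (fun j => G i j k x y * Y j x y))).
Proof. reflexivity. Qed.

Lemma bracket_eq X Y k x y : bracket X Y k x y =
  sum_idx (fun i => X i x y * pd i (Y k) x y - Y i x y * pd i (X k) x y).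
Proof. reflexivity. Qed.

Lemma pd_nabla U G X Y i k x y : open U -> smooth_christoffel U G ->
  smooth_vfield U X -> smooth_vfield U Y -> U (x, y) ->
  pd i (nabla G X Y k) x y =
  sum_idx (fun j =>
    pd i (X j) x y * (pd j (Y k) x y + sum_idx (fun l => G j l k x y * Y l x y)) +
    X j x y * (pd i (pd j (Y k)) x y +
      sum_idx (fun l => pd i (G j l k) x y * Y l x y + G j l k x y * pd i (Y l) x y))).
Proof.
  intros oU HG HX HY Uxy. unfold nabla, sum_idx.
  repeat first [ rewrite (pd_plus U) | rewrite (pd_mult U) ];
    try exact Uxy; smoothness.
  reflexivity.
Qed.

Lemma pd_bracket U X Y i k x y : open U ->
  smooth_vfield U X -> smooth_vfield U Y -> U (x, y) ->
  pd i (bracket X Y k) x y =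
  sum_idx (fun j =>
    pd i (X j) x y * pd j (Y k) x y + X j x y * pd i (pd j (Y k)) x y -
    (pd i (Y j) x y * pd j (X k) x y + Y j x y * pd i (pd j (X k)) x y)).
Proof.
  intros oU HX HY Uxy. unfold bracket, sum_idx.
  repeat first [ rewrite (pd_minus U) | rewrite (pd_plus U) | rewrite (pd_mult U) ];
    try exact Uxy; smoothness.
  reflexivity.
Qed.

(** The k-th component of R(d_i, d_j) d_l. *)
Definition riemann (G : christoffel) (i j l k : idx) : sfun := fun x y =>
  pd i (G j l k) x y - pd j (G i l k) x y +
  sum_idx (fun m => G i m k x y * G j l m x y - G j m k x y * G i l m x y).

(** Curvature is a tensor: second derivatives of [Z] cancel by symmetry and all
    derivatives of [X], [Y] cancel against the bracket term. *)
Lemma curvature_riemann U G X Y Z k x y : open U -> smooth_christoffel U G ->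
  smooth_vfield U X -> smooth_vfield U Y -> smooth_vfield U Z -> U (x, y) ->
  curvature G X Y Z k x y =
  sum_idx (fun i => sum_idx (fun j => sum_idx (fun l =>
    X i x y * Y j x y * Z l x y * riemann G i j l k x y))).
Proof.
  intros oU HG HX HY HZ Uxy.
  unfold curvature, vsub.
  rewrite (nabla_eq G X (nabla G Y Z)), (nabla_eq G Y (nabla G X Z)).
  unfold sum_idx.
  rewrite !(pd_nabla U) by assumption.
  unfold riemann, nabla, bracket, sum_idx.
  rewrite !(pd_comm U (Z _)) by (try assumption; apply HZ).
  ring.
Qed.

(** The component (L_X nabla)_ij^k. *)
Definition lie_christoffel (G : christoffel) (X : vfield) (i j k : idx) : sfun :=
  fun x y => pd i (pd j (X k)) x y +
    sum_idx (fun l => X l x y * pd l (G i j k) x y + G l j k x y * pd i (X l) x y +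
      G i l k x y * pd j (X l) x y - G i j l x y * pd l (X k) x y).

(** The Lie derivative of a connection is a tensor, again by symmetry of second
    derivatives. *)
Lemma lie_connection_christoffel U G X Y Z k x y : open U -> smooth_christoffel U G ->
  smooth_vfield U X -> smooth_vfield U Y -> smooth_vfield U Z -> U (x, y) ->
  lie_connection G X Y Z k x y =
  sum_idx (fun i => sum_idx (fun j =>
    Y i x y * Z j x y * lie_christoffel G X i j k x y)).
Proof.
  intros oU HG HX HY HZ Uxy.
  unfold lie_connection, vsub.
  rewrite (bracket_eq X (nabla G Y Z)), (nabla_eq G Y (bracket X Z)).
  unfold sum_idx.
  rewrite !(pd_nabla U), !(pd_bracket U) by assumption.
  unfold lie_christoffel, nabla, bracket, sum_idx.
  rewrite !(pd_comm U (Z _)) by (try assumption; apply HZ).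
  rewrite !(pd_comm U (X _)) by (try assumption; apply HX).
  ring.
Qed.

Lemma affine_killing_of_components U G X : open U -> smooth_christoffel U G ->
  smooth_vfield U X ->
  (forall i j k x y, U (x, y) -> lie_christoffel G X i j k x y = 0) ->
  affine_killing U G X.
Proof.
  intros oU HG HX H. split; [exact HX|]. intros Y Z HY HZ x y Uxy k.
  rewrite (lie_connection_christoffel U) by assumption.
  unfold sum_idx. rewrite !H by exact Uxy. ring.
Qed.

Lemma flat_of_riemann U G : open U -> smooth_christoffel U G ->
  (forall i j l k x y, U (x, y) -> riemann G i j l k x y = 0) -> flat U G.
Proof.
  intros oU HG H X Y Z HX HY HZ x y Uxy k.
  rewrite (curvature_riemann U) by assumption.
  unfold sum_idx. rewrite !H by exact Uxy. ring.
Qed.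

Lemma smooth_frame U i : open U -> smooth_vfield U (frame i).
Proof. intros oU k. exact (smooth_const U (delta i k) oU). Qed.

Lemma riemann_of_flat U G i j l k x y : open U -> smooth_christoffel U G ->
  flat U G -> U (x, y) -> riemann G i j l k x y = 0.
Proof.
  intros oU HG H Uxy.
  rewrite <- (H (frame i) (frame j) (frame l)) with (x := x) (y := y) (k := k)
    by (try apply smooth_frame; assumption).
  rewrite (curvature_riemann U)
    by (try apply smooth_frame; assumption).
  unfold sum_idx, frame. destruct i, j, l; simpl; ring.
Qed.

Lemma nabla_frame G i j k x y : nabla G (frame i) (frame j) k x y = G i j k x y.
Proof.
  unfold nabla, sum_idx, frame.
  rewrite !pd_const. destruct i, j; simpl; ring.
Qed.

Lemma ricci_riemann U G i j x y : open U -> smooth_christoffel U G -> U (x, y) ->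
  ricci G (frame i) (frame j) x y = sum_idx (fun k => riemann G k i j k x y).
Proof.
  intros oU HG Uxy. unfold ricci, sum_idx.
  rewrite !(curvature_riemann U) by (try apply smooth_frame; assumption).
  unfold sum_idx, frame. destruct i, j; simpl; ring.
Qed.

(** * Type B models *)

Lemma smooth_typeB C : smooth_christoffel half_plane (typeB C).
Proof. intros i j k. unfold typeB. smoothness. Qed.

Lemma pd_typeB C l i j k x y : 0 < x ->
  pd l (typeB C i j k) x y = - delta I1 l * (/ x * / x) * C i j k.
Proof.
  intro Hx. unfold typeB.
  rewrite (pd_mult half_plane (fun x _ => / x) (fun _ _ => C i j k))
    by (try exact Hx; smoothness).
  rewrite pd_inv, pd_const by exact Hx. ring.
Qed.

(** x^2 times the curvature component of [typeB C]; the terms with [delta] come from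
    the derivative of 1/x. *)
Definition riemann_coeff (C : idx -> idx -> idx -> R) (i j l k : idx) : R :=
  delta I1 j * C i l k - delta I1 i * C j l k +
  sum_idx (fun m => C i m k * C j l m - C j m k * C i l m).

Lemma riemann_typeB C i j l k x y : 0 < x ->
  riemann (typeB C) i j l k x y = / x * / x * riemann_coeff C i j l k.
Proof.
  intro Hx. unfold riemann. rewrite !pd_typeB by exact Hx.
  unfold riemann_coeff, typeB, sum_idx. ring.
Qed.

Lemma ricci_typeB C i j x y : 0 < x ->
  ricci (typeB C) (frame i) (frame j) x y =
  / x * / x * sum_idx (fun k => riemann_coeff C k i j k).
Proof.
  intro Hx. rewrite (ricci_riemann half_plane)
    by (try exact Hx; try exact open_half_plane; apply smooth_typeB).
  unfold sum_idx. rewrite !riemann_typeB by exact Hx. ring.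
Qed.

Lemma ricci_model c e i j x y : 0 < x ->
  ricci (typeB (modelC c e)) (frame i) (frame j) x y =
  / x * / x * match i, j with
              | I1, I1 => c * (2 + c)
              | I2, I2 => e * c
              | _, _ => 0
              end.
Proof.
  intro Hx. rewrite ricci_typeB by exact Hx.
  unfold sum_idx, riemann_coeff, sum_idx. destruct i, j; simpl; ring.
Qed.

(** Matrix of the linear map (x, y) |-> (x, a x + b y): [jac a b i k] is the
    derivative of its k-th component in the i-th variable. *)
Definition jac (a b : R) (i k : idx) : R :=
  match i, k with
  | I1, I1 => 1 | I1, I2 => a
  | I2, I1 => 0 | I2, I2 => b
  end.

(** Transformation law of Christoffel symbols; it has no second-derivative term
    because the map is linear, and 1/x is common to both sides because the map
    preserves x. *)
Definition conjugate (a b : R) (C C' : idx -> idx -> idx -> R) : Prop :=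
  forall i j l, sum_idx (fun k => C i j k * jac a b k l) =
    sum_idx (fun k => sum_idx (fun m => jac a b i k * jac a b j m * C' k m l)).

Lemma push_eq a b X k x u :
  push a b X k x u = sum_idx (fun j => jac a b j k * X j x ((u - a * x) / b)).
Proof. destruct k; unfold push, sum_idx; simpl; ring. Qed.

Lemma pd_push a b X i k x u : b <> 0 -> smooth_vfield half_plane X -> 0 < x ->
  let y := (u - a * x) / b in
  let F := fun x y => sum_idx (fun j => jac a b j k * X j x y) in
  pd i (push a b X k) x u =
  match i with
  | I1 => pd I1 F x y - a / b * pd I2 F x y
  | I2 => / b * pd I2 F x y
  end.
Proof.
  intros Hb HX Hx y F.
  assert (SF : smooth half_plane F) by (unfold F, sum_idx; smoothness).
  assert (E1 : push a b X k = fun x u => F x ((u - a * x) / b)).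
  { apply functional_extensionality; intro t. apply functional_extensionality; intro v.
    apply push_eq. }
  rewrite E1.
  assert (D := smooth_differentiable half_plane F x y open_half_plane SF Hx).
  destruct i; apply is_derive_unique, is_derive_Reals.
  - replace (pd I1 F x y - a / b * pd I2 F x y)
      with (pd I1 F x y * 1 + pd I2 F x y * (- (a / b))) by ring.
    apply (derivable_pt_lim_comp_2d F (fun t => t) (fun t => (u - a * t) / b)).
    + exact D.
    + apply is_derive_Reals. auto_derive; [exact I | ring].
    + apply is_derive_Reals. auto_derive; [exact I | field; exact Hb].
  - replace (/ b * pd I2 F x y) with (pd I1 F x y * 0 + pd I2 F x y * / b) by ring.
    apply (derivable_pt_lim_comp_2d F (fun _ => x) (fun t => (t - a * x) / b)).
    + exact D.
    + apply is_derive_Reals. auto_derive; [exact I | ring].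
    + apply is_derive_Reals. auto_derive; [exact I | field; exact Hb].
Qed.

(** Frames detect the transformation law; for arbitrary fields it then follows
    from the chain rule. *)
Lemma intertwines_iff_conjugate a b C C' : b <> 0 ->
  (forall X Y, smooth_vfield half_plane X -> smooth_vfield half_plane Y ->
     eq_vfield half_plane (push a b (nabla (typeB C) X Y))
       (nabla (typeB C') (push a b X) (push a b Y))) <-> conjugate a b C C'.
Proof.
  intro Hb. split.
  - intros H i j l.
    assert (E := H (frame i) (frame j) (smooth_frame _ i open_half_plane)
                   (smooth_frame _ j open_half_plane) 1 0 Rlt_0_1 l).
    rewrite push_eq in E. unfold sum_idx in E. rewrite !nabla_frame in E.
    rewrite nabla_eq in E. unfold sum_idx in E.
    rewrite !pd_push, !push_eq in E
      by first [exact Hb | exact Rlt_0_1 | apply smooth_frame, open_half_plane].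
    unfold sum_idx, frame in E. rewrite !pd_const in E. unfold typeB in E.
    rewrite Rinv_1 in E. unfold sum_idx. destruct i, j; simpl in *; lra.
  - intros H X Y HX HY x u Hx l. unfold half_plane in Hx; simpl in Hx.
    rewrite push_eq. unfold sum_idx. rewrite !nabla_eq. unfold sum_idx.
    rewrite !pd_push, !push_eq by assumption. unfold sum_idx.
    set (y := (u - a * x) / b).
    repeat first [ rewrite (pd_plus half_plane) | rewrite (pd_mult half_plane) ];
      try exact Hx; smoothness.
    rewrite !pd_const. unfold typeB.
    assert (E11 := H I1 I1 l). assert (E12 := H I1 I2 l).
    assert (E21 := H I2 I1 l). assert (E22 := H I2 I2 l).
    unfold sum_idx in *. apply Rminus_diag_uniq.
    match type of E11 with ?l11 = ?r11 => match type of E12 with ?l12 = ?r12 =>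
    match type of E21 with ?l21 = ?r21 => match type of E22 with ?l22 = ?r22 =>
      transitivity (/ x * (X I1 x y * Y I1 x y * (l11 - r11) + X I1 x y * Y I2 x y * (l12 - r12)
        + X I2 x y * Y I1 x y * (l21 - r21) + X I2 x y * Y I2 x y * (l22 - r22)))
    end end end end.
    + destruct l; simpl; field; split; lra.
    + rewrite E11, E12, E21, E22. ring.
Qed.

Lemma linearly_isomorphic_conjugate C C' :
  linearly_isomorphic (typeB C) (typeB C') <->
  exists a b, b <> 0 /\ conjugate a b C C'.
Proof.
  split; intros (a & b & Hb & H); exists a, b; (split; [exact Hb|]);
    revert H; apply intertwines_iff_conjugate; exact Hb.
Qed.

(** * Projective flatness of a type B model *)

Definition ricci_coeff (C : idx -> idx -> idx -> R) (i j : idx) : R :=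
  sum_idx (fun k => riemann_coeff C k i j k).

(** x^3 times the component (nabla_i rho)_jk. *)
Definition nabla_ricci_coeff (C : idx -> idx -> idx -> R) (i j k : idx) : R :=
  -2 * delta I1 i * ricci_coeff C j k -
  sum_idx (fun l => C i j l * ricci_coeff C l k + C i k l * ricci_coeff C j l).

Lemma proj_related_christoffel U G G0 w i j k x y : open U ->
  proj_related U G G0 w -> U (x, y) ->
  G0 i j k x y = G i j k x y - (w i x y * delta j k + w j x y * delta i k).
Proof.
  intros oU H Uxy.
  assert (E1 := H (frame i) (frame j) (smooth_frame U i oU) (smooth_frame U j oU)
                 x y Uxy k).
  unfold vadd, vscale, pairing, sum_idx in E1. rewrite !nabla_frame in E1.
  rewrite E1. unfold frame. destruct i, j; simpl; ring.
Qed.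

Lemma smooth_subset (U V : region) f :
  (forall q, V q -> U q) -> smooth U f -> smooth V f.
Proof. intros VU Hf x y Vxy. exact (Hf x y (VU _ Vxy)). Qed.

(** This is the vanishing of the Ricci tensor of the flat connection
    Gamma - w. In it the derivatives of w occur as - d_j w_i - d_i w_j + 3 d_i w_j,
    and closedness of w reduces this to d_i w_j. *)
Lemma ricci_flat_oneform C V G0 w : (forall i j k, C i j k = C j i k) ->
  open V -> (forall q, V q -> half_plane q) -> smooth_christoffel V G0 -> flat V G0 ->
  closed_oneform V w -> proj_related V (typeB C) G0 w ->
  forall i j x y, V (x, y) ->
  pd i (w j) x y = / x * sum_idx (fun k => C i j k * w k x y)
    - / x * / x * ricci_coeff C i j - w i x y * w j x y.
Proof.
  intros HC oV VU HG0 F0 (Sw & Cl) HP i j x y Vxy.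
  assert (Hx : 0 < x) by exact (VU _ Vxy).
  assert (ST : smooth_christoffel V (typeB C)).
  { intros i' j' k'. exact (smooth_subset half_plane V _ VU (smooth_typeB C i' j' k')). }
  assert (D : forall i j l k, pd i (G0 j l k) x y = pd i (typeB C j l k) x y
            - (pd i (w j) x y * delta l k + pd i (w l) x y * delta j k)).
  { clear HG0 F0. revert ST HP. generalize (typeB C). intros T ST HP i' j' l k.
    rewrite (pd_ext V (G0 j' l k) (fun u v => T j' l k u v
              - (w j' u v * delta l k + w l u v * delta j' k)) i' x y oV Vxy).
    - repeat first [ rewrite (pd_minus V) | rewrite (pd_plus V) | rewrite (pd_mult V) ];
        try exact Vxy; smoothness; try apply Sw.
      rewrite !pd_const. ring.
    - intros u v Huv. exact (proj_related_christoffel V _ _ w j' l k u v oV HP Huv). }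
  assert (Q : forall k, riemann G0 k i j k x y = 0).
  { intro k. apply (riemann_of_flat V); assumption. }
  assert (Q1 := Q I1). assert (Q2 := Q I2). clear Q.
  unfold riemann, sum_idx in Q1, Q2.
  assert (P := fun i j k => proj_related_christoffel V _ _ w i j k x y oV HP Vxy).
  rewrite !D, !P in Q1, Q2.
  rewrite !pd_typeB in Q1, Q2 by exact Hx.
  assert (Cxy := Cl x y Vxy).
  unfold ricci_coeff, riemann_coeff, sum_idx. unfold typeB in Q1, Q2.
  destruct i, j; simpl in *; rewrite ?(HC I2 I1) in *; lra.
Qed.

(** Integrability conditions of the system [ricci_flat_oneform]: closedness of w
    gives the symmetry of rho, and the commutation of d_1 and d_2 on w_j that of
    nabla rho. In the latter all terms containing w cancel, because a surface has
    no Weyl projective curvature. *)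
Lemma strongly_proj_flat_codazzi C : (forall i j k, C i j k = C j i k) ->
  strongly_proj_flat half_plane (typeB C) ->
  ricci_coeff C I1 I2 = ricci_coeff C I2 I1 /\
  forall j, nabla_ricci_coeff C I1 I2 j = nabla_ricci_coeff C I2 I1 j.
Proof.
  intros HC H. assert (P0 : half_plane (1, 0)) by exact Rlt_0_1.
  destruct (H (1, 0) P0)
    as (V & G0 & w & oV & Vp & VU & SG0 & _ & F0 & Cw & HP).
  assert (D := ricci_flat_oneform C V G0 w HC oV VU SG0 F0 Cw HP).
  destruct Cw as (Sw & Cl).
  assert (Sym : ricci_coeff C I1 I2 = ricci_coeff C I2 I1).
  { assert (E1 := Cl 1 0 Vp). rewrite !D in E1 by exact Vp.
    rewrite Rinv_1 in E1. unfold sum_idx in E1. rewrite !(HC I2 I1) in E1. lra. }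
  split; [exact Sym|]. intro j.
  assert (DD : forall k i, pd k (pd i (w j)) 1 0 =
    - delta I1 k * sum_idx (fun l => C i j l * w l 1 0)
    + sum_idx (fun l => C i j l * pd k (w l) 1 0)
    + 2 * delta I1 k * ricci_coeff C i j
    - (pd k (w i) 1 0 * w j 1 0 + w i 1 0 * pd k (w j) 1 0)).
  { intros k i.
    rewrite (pd_ext V _ _ k 1 0 oV Vp (fun u v Huv => D i j u v Huv)).
    assert (Si : smooth V (fun x _ => / x)).
    { exact (smooth_subset half_plane V _ VU smooth_inv). }
    unfold sum_idx.
    repeat first [ rewrite (pd_minus V) | rewrite (pd_plus V) | rewrite (pd_mult V) ];
      try exact Vp; smoothness; try apply Sw.
    rewrite !pd_const, !pd_inv by exact Rlt_0_1. rewrite Rinv_1. ring. }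
  assert (E1 := pd_comm V (w j) 1 0 oV (Sw j) Vp).
  rewrite !DD in E1. unfold sum_idx in E1.
  rewrite !D in E1 by exact Vp. rewrite Rinv_1 in E1. unfold sum_idx in E1.
  unfold nabla_ricci_coeff. clear D DD.
  unfold ricci_coeff, riemann_coeff, sum_idx in *. simpl in Sym, E1 |- *.
  rewrite !(HC I2 I1) in Sym, E1 |- *.
  assert (T : C I2 I2 I2 = - C I1 I2 I1) by lra.
  rewrite T in E1 |- *.
  destruct j; simpl in E1 |- *; rewrite ?(HC I2 I1) in E1 |- *; lra.
Qed.

(** The equation for nabla rho with j = 2 becomes 6 (C_12^1)^2 = 0. *)
Lemma codazzi_C221_zero C : (forall i j k, C i j k = C j i k) ->
  ricci_coeff C I1 I2 = ricci_coeff C I2 I1 ->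
  (forall j, nabla_ricci_coeff C I1 I2 j = nabla_ricci_coeff C I2 I1 j) ->
  C I2 I2 I1 = 0 -> C I1 I2 I1 = 0 /\ C I2 I2 I2 = 0.
Proof.
  intros HC HS HN H0. assert (N2 := HN I2). clear HN.
  unfold nabla_ricci_coeff, ricci_coeff, riemann_coeff, sum_idx in *.
  simpl in HS, N2. rewrite !(HC I2 I1), H0 in HS, N2.
  assert (T : C I2 I2 I2 = - C I1 I2 I1) by lra. rewrite T in *.
  assert (Z : C I1 I2 I1 * C I1 I2 I1 = 0) by lra.
  destruct (Rmult_integral _ _ Z) as [-> | ->]; split; ring.
Qed.

(** With e = C_22^1 <> 0 the shear u = y + s x with s = C_12^1 / e produces
    constants with C_12^1 = C_22^2 = 0, in which the two remaining equations read
    3 e C_11^2 = 0 and C_11^1 = 1 + 2 m, where m is the new C_12^2. The conclusion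
    is the pull-back of this normal form by the shear. *)
Lemma codazzi_normal_form C : (forall i j k, C i j k = C j i k) ->
  ricci_coeff C I1 I2 = ricci_coeff C I2 I1 ->
  (forall j, nabla_ricci_coeff C I1 I2 j = nabla_ricci_coeff C I2 I1 j) ->
  C I2 I2 I1 <> 0 ->
  exists m s, C I1 I1 I1 = 1 + 2 * m + s * s * C I2 I2 I1 /\
    C I1 I1 I2 = - s * (1 + s * s * C I2 I2 I1) /\
    C I1 I2 I1 = s * C I2 I2 I1 /\ C I1 I2 I2 = m - s * s * C I2 I2 I1 /\
    C I2 I2 I2 = - s * C I2 I2 I1.
Proof.
  intros HC HS HN H0. assert (N1 := HN I1). assert (N2 := HN I2). clear HN.
  unfold nabla_ricci_coeff, ricci_coeff, riemann_coeff, sum_idx in *.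
  simpl in HS, N1, N2. rewrite !(HC I2 I1) in HS, N1, N2.
  assert (T : C I2 I2 I2 = - C I1 I2 I1) by lra. rewrite T in *.
  (* r and t are the deviations of the sheared C_11^1 and C_11^2 from their
     expected values. *)
  set (s := C I1 I2 I1 / C I2 I2 I1).
  assert (E1 : C I1 I2 I1 = s * C I2 I2 I1) by (unfold s; field; exact H0).
  set (m := C I1 I2 I2 + s * s * C I2 I2 I1).
  set (r := C I1 I1 I1 - s * s * C I2 I2 I1 - 1 - 2 * m).
  set (t := C I1 I1 I2 + s * (1 + s * s * C I2 I2 I1)).
  assert (Em : C I1 I2 I2 = m - s * s * C I2 I2 I1) by (unfold m; ring).
  assert (Er : C I1 I1 I1 = 1 + 2 * m + s * s * C I2 I2 I1 + r) by (unfold r; ring).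
  assert (Et : C I1 I1 I2 = t - s * (1 + s * s * C I2 I2 I1)) by (unfold t; ring).
  clearbody s m r t. rewrite E1, Em, Er, Et in N1, N2.
  assert (R0 : r * C I2 I2 I1 = 0) by lra.
  assert (r = 0) by (destruct (Rmult_integral _ _ R0); tauto).
  subst r.
  assert (T0 : t * C I2 I2 I1 = 0) by lra.
  assert (t = 0) by (destruct (Rmult_integral _ _ T0); tauto).
  subst t. exists m, s. repeat split; lra.
Qed.

(** Rescaling u by b turns C_22^1 = e b^2 into e. *)
Lemma conjugate_normal_form C m s b e : (forall i j k, C i j k = C j i k) ->
  b <> 0 -> C I2 I2 I1 = e * (b * b) ->
  C I1 I1 I1 = 1 + 2 * m + s * s * C I2 I2 I1 ->
  C I1 I1 I2 = - s * (1 + s * s * C I2 I2 I1) ->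
  C I1 I2 I1 = s * C I2 I2 I1 -> C I1 I2 I2 = m - s * s * C I2 I2 I1 ->
  C I2 I2 I2 = - s * C I2 I2 I1 ->
  conjugate (s * b) b C (modelC m e).
Proof.
  intros HC Hb He E1 E2 E3 E4 E5 i j l.
  unfold sum_idx. destruct i, j, l; simpl; rewrite ?(HC I2 I1), ?E1, ?E2, ?E3, ?E4, ?E5, ?He; ring.
Qed.

(** * Affine Killing fields of type B models *)

Ltac explicit_pd :=
  unfold pd; simpl; apply is_derive_unique; auto_derive;
  [repeat split; try lra | try (field; lra)].

(** The Killing equation of a field whose first and second derivatives are given
    by explicit formulas [DX] and [DDX]. *)
Lemma typeB_killing C X (DX : idx -> idx -> sfun) (DDX : idx -> idx -> idx -> sfun) :
  smooth_vfield half_plane X ->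
  (forall i k x y, 0 < x -> pd i (X k) x y = DX i k x y) ->
  (forall i j k x y, 0 < x -> pd i (DX j k) x y = DDX i j k x y) ->
  (forall i j k x y, 0 < x -> DDX i j k x y
     + / x * (sum_idx (fun l => C l j k * DX i l x y + C i l k * DX j l x y
                               - C i j l * DX l k x y) - / x * C i j k * X I1 x y) = 0) ->
  affine_killing half_plane (typeB C) X.
Proof.
  intros HX H1 H2 H.
  apply affine_killing_of_components;
    [exact open_half_plane | apply smooth_typeB | exact HX|].
  intros i j k x y Hx. unfold lie_christoffel, sum_idx.
  rewrite (pd_ext half_plane _ (DX j k) i x y open_half_plane Hx
             (fun u v Hu => H1 j k u v Hu)).
  rewrite H2, !pd_typeB, !H1 by exact Hx.
  rewrite <- (H i j k x y Hx). unfold typeB, sum_idx. simpl. ring.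
Qed.

Definition dilation : vfield := fun k x y => match k with I1 => x | I2 => y end.

Lemma translation_killing C : affine_killing half_plane (typeB C) (frame I2).
Proof.
  apply (typeB_killing C _ (fun _ _ _ _ => 0) (fun _ _ _ _ _ => 0)).
  - apply smooth_frame, open_half_plane.
  - intros. apply pd_const.
  - intros. apply pd_const.
  - intros. unfold frame, sum_idx. simpl. ring.
Qed.

Lemma dilation_killing C : affine_killing half_plane (typeB C) dilation.
Proof.
  apply (typeB_killing C _ (fun i k _ _ => delta i k) (fun _ _ _ _ _ => 0)).
  - intros [|]; [apply smooth_x | apply smooth_y]; exact open_half_plane.
  - intros [|] [|] x y _; first [exact (pd_x _ x y) | exact (pd_y _ x y)].
  - intros. apply pd_const.
  - intros i j k x y Hx. unfold sum_idx, dilation.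
    destruct i, j, k; simpl; field; lra.
Qed.

(** For such constants the Killing equation of g(x) d_2 is the Euler equation
    g'' = (C_11^1 - 2 C_12^2) g' / x. *)
Lemma vertical_killing C (g g' : R -> R) : (forall i j k, C i j k = C j i k) ->
  C I1 I2 I1 = 0 -> C I2 I2 I1 = 0 -> C I2 I2 I2 = 0 ->
  smooth half_plane (fun x _ => g x) ->
  (forall x, 0 < x -> is_derive g x (g' x)) ->
  (forall x, 0 < x -> is_derive g' x ((C I1 I1 I1 - 2 * C I1 I2 I2) * / x * g' x)) ->
  affine_killing half_plane (typeB C)
    (fun k x _ => match k with I1 => 0 | I2 => g x end).
Proof.
  intros HC H1 H2 H3 Sg Dg Dg'.
  apply (typeB_killing C _
    (fun i k x _ => match i, k with I1, I2 => g' x | _, _ => 0 end)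
    (fun i j k x _ => match i, j, k with
       | I1, I1, I2 => (C I1 I1 I1 - 2 * C I1 I2 I2) * / x * g' x | _, _, _ => 0 end)).
  - intros [|]; [apply smooth_const, open_half_plane | exact Sg].
  - intros [|] [|] x y Hx; try solve [apply pd_const | exact (Derive_const _ y)]. exact (is_derive_unique _ _ _ (Dg x Hx)).
  - intros [|] [|] [|] x y Hx; try solve [apply pd_const | exact (Derive_const _ y)].
    exact (is_derive_unique _ _ _ (Dg' x Hx)).
  - intros i j k x y Hx. unfold sum_idx.
    destruct i, j, k; simpl; rewrite ?(HC I2 I1), ?H1, ?H2, ?H3; ring.
Qed.

(** The case m = 0 of the normal form, which is flat with affine coordinates
    u = y + s x and x^2 + e u^2, where e = C_22^1. The Killing field is twice the
    coordinate field of the second one. *)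
Lemma flat_model_killing C s : (forall i j k, C i j k = C j i k) ->
  C I1 I1 I1 = 1 + s * s * C I2 I2 I1 ->
  C I1 I1 I2 = - s * (1 + s * s * C I2 I2 I1) ->
  C I1 I2 I1 = s * C I2 I2 I1 -> C I1 I2 I2 = - s * s * C I2 I2 I1 ->
  C I2 I2 I2 = - s * C I2 I2 I1 ->
  affine_killing half_plane (typeB C)
    (fun k x _ => match k with I1 => / x | I2 => - s * / x end).
Proof.
  intros HC E1 E2 E3 E4 E5.
  apply (typeB_killing C _
    (fun i k x _ => match i, k with
       | I1, I1 => - (/ x * / x) | I1, I2 => s * (/ x * / x) | _, _ => 0 end)
    (fun i j k x _ => match i, j, k with
       | I1, I1, I1 => 2 * (/ x * / x * / x)
       | I1, I1, I2 => -2 * s * (/ x * / x * / x) | _, _, _ => 0 end)).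
  - intros [|]; smoothness.
  - intros [|] [|] x y Hx; try solve [apply pd_const | exact (Derive_const _ y)]; explicit_pd.
  - intros [|] [|] [|] x y Hx; try solve [apply pd_const | exact (Derive_const _ y)]; explicit_pd.
  - intros i j k x y Hx. unfold sum_idx.
    destruct i, j, k; simpl; rewrite ?(HC I2 I1), ?E1, ?E2, ?E3, ?E4, ?E5; ring.
Qed.

(** The case m = -1 of the normal form, which is the Levi-Civita connection of the
    metric (dx^2 + e du^2) / x^2 with u = y + s x and e = C_22^1. The Killing field
    2 x u d_x + (u^2 - x^2 / e) d_u corresponds, for e = 1, to the holomorphic
    field z^2 d_z with z = u + i x. *)
Lemma hyperbolic_model_killing C s : (forall i j k, C i j k = C j i k) ->
  C I2 I2 I1 <> 0 ->
  C I1 I1 I1 = -1 + s * s * C I2 I2 I1 ->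
  C I1 I1 I2 = - s * (1 + s * s * C I2 I2 I1) ->
  C I1 I2 I1 = s * C I2 I2 I1 -> C I1 I2 I2 = -1 - s * s * C I2 I2 I1 ->
  C I2 I2 I2 = - s * C I2 I2 I1 ->
  affine_killing half_plane (typeB C)
    (fun k x y => match k with
       | I1 => 2 * x * (y + s * x)
       | I2 => (y + s * x) * (y + s * x) - / C I2 I2 I1 * (x * x)
               - 2 * s * x * (y + s * x)
       end).
Proof.
  intros HC H0 E1 E2 E3 E4 E5.
  apply (typeB_killing C _
    (fun i k x y => match i, k with
       | I1, I1 => 2 * y + 4 * s * x | I2, I1 => 2 * x
       | I1, I2 => -2 * (/ C I2 I2 I1 + s * s) * x | I2, I2 => 2 * y end)
    (fun i j k x _ => match i, j, k with
       | I1, I1, I1 => 4 * s | I1, I2, I1 | I2, I1, I1 => 2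
       | I1, I1, I2 => -2 * (/ C I2 I2 I1 + s * s)
       | I2, I2, I2 => 2 | _, _, _ => 0 end)).
  - intros [|]; smoothness.
  - generalize (/ C I2 I2 I1). intros q [|] [|] x y Hx; explicit_pd.
  - generalize (/ C I2 I2 I1). intros q [|] [|] [|] x y Hx; explicit_pd.
  - intros i j k x y Hx. unfold sum_idx. assert (Hx0 : x <> 0) by lra.
    destruct i, j, k; simpl; rewrite ?(HC I2 I1), ?E1, ?E2, ?E3, ?E4, ?E5;
      field; auto.
Qed.

Lemma has_dim2_dependent U V X1 X2 X3 : has_dim U V 2 -> V X1 -> V X2 -> V X3 ->
  exists p q r, ~ (p = 0 /\ q = 0 /\ r = 0) /\
    forall k x y, U (x, y) -> p * X1 k x y + q * X2 k x y + r * X3 k x y = 0.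
Proof.
  intros (B & _ & _ & HB) V1 V2 V3.
  destruct (HB X1 V1) as (a1 & E1). destruct (HB X2 V2) as (a2 & E2).
  destruct (HB X3 V3) as (a3 & E3).
  (* The cross product of the two coordinate columns. *)
  set (p := a2 0%nat * a3 1%nat - a3 0%nat * a2 1%nat).
  set (q := a3 0%nat * a1 1%nat - a1 0%nat * a3 1%nat).
  set (r := a1 0%nat * a2 1%nat - a2 0%nat * a1 1%nat).
  assert (W : forall p q r,
    p * a1 0%nat + q * a2 0%nat + r * a3 0%nat = 0 ->
    p * a1 1%nat + q * a2 1%nat + r * a3 1%nat = 0 ->
    forall k x y, U (x, y) -> p * X1 k x y + q * X2 k x y + r * X3 k x y = 0).
  { clear p q r. intros p q r H0 H1 k x y Uxy.
    rewrite (E1 x y Uxy k), (E2 x y Uxy k), (E3 x y Uxy k).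
    unfold lincomb. simpl.
    transitivity ((p * a1 0%nat + q * a2 0%nat + r * a3 0%nat) * B 0%nat k x y +
                  (p * a1 1%nat + q * a2 1%nat + r * a3 1%nat) * B 1%nat k x y);
      [ring | rewrite H0, H1; ring]. }
  destruct (Req_dec r 0) as [R0 | R0].
  - (* The coordinate rows of X1 and X2 are parallel. *)
    destruct (Req_dec (a1 0%nat) 0) as [A0 | A0].
    + destruct (Req_dec (a1 1%nat) 0) as [A1 | A1].
      * exists 1, 0, 0. split; [lra|]. apply W; rewrite ?A0, ?A1; ring.
      * exists (- a2 1%nat), (a1 1%nat), 0. split; [tauto|].
        apply W; [|ring]. unfold r in R0. lra.
    + exists (- a2 0%nat), (a1 0%nat), 0. split; [tauto|].
      apply W; [ring|]. unfold r in R0. lra.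
  - exists p, q, r. split; [tauto|]. apply W; unfold p, q, r; ring.
Qed.

(** In dimension two the Killing fields are spanned by the translation and the
    dilation, so any further one is a combination of these. *)
Lemma dim2_killing_dependent C X :
  has_dim half_plane (affine_killing half_plane (typeB C)) 2 ->
  affine_killing half_plane (typeB C) X ->
  exists p q r, ~ (p = 0 /\ q = 0 /\ r = 0) /\
    (forall x y, 0 < x -> q * x + r * X I1 x y = 0) /\
    (forall x y, 0 < x -> p + q * y + r * X I2 x y = 0).
Proof.
  intros H HX.
  destruct (has_dim2_dependent _ _ _ _ _ H (translation_killing C)
              (dilation_killing C) HX) as (p & q & r & N & D).
  exists p, q, r. split; [exact N|]. split; intros x y Hx.
  - rewrite <- (D I1 x y Hx). unfold frame, dilation. simpl. ring.
  - rewrite <- (D I2 x y Hx). unfold frame, dilation. simpl. ring.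
Qed.

Lemma dim2_no_vertical_killing C g :
  has_dim half_plane (affine_killing half_plane (typeB C)) 2 ->
  affine_killing half_plane (typeB C)
    (fun k x _ => match k with I1 => 0 | I2 => g x end) -> g 1 = g 2.
Proof.
  intros H HX. destruct (dim2_killing_dependent C _ H HX) as (p & q & r & N & D1 & D2).
  assert (A := D1 1 0 Rlt_0_1). assert (B1 := D2 1 0 Rlt_0_1).
  assert (B2 := D2 2 0 Rlt_0_2). cbv beta iota in *.
  assert (q = 0) by lra. subst q.
  assert (Z : r * (g 1 - g 2) = 0) by lra.
  destruct (Rmult_integral _ _ Z) as [-> | Z']; [|lra].
  exfalso. apply N. repeat split; lra.
Qed.

Lemma Rpower_2_neq_1 s : s <> 0 -> Rpower 2 s <> 1.
Proof.
  intros Hs E1. apply Hs. unfold Rpower in E1. rewrite <- exp_0 in E1.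
  apply exp_inv in E1. assert (L := ln_lt_2).
  destruct (Rmult_integral _ _ E1); [assumption | lra].
Qed.

(** Otherwise [vertical_killing] applies with g = x^s, where
    s = 1 + C_11^1 - 2 C_12^2, or with g = log x when s = 0. *)
Lemma dim2_C221_neq0 C : (forall i j k, C i j k = C j i k) ->
  has_dim half_plane (affine_killing half_plane (typeB C)) 2 ->
  C I1 I2 I1 = 0 -> C I2 I2 I2 = 0 -> C I2 I2 I1 <> 0.
Proof.
  intros HC H Z1 Z2 Z3.
  set (s := 1 + C I1 I1 I1 - 2 * C I1 I2 I2).
  destruct (Req_dec s 0) as [S0 | S0].
  - assert (E1 : ln 1 = ln 2).
    { apply (dim2_no_vertical_killing C ln H).
      apply (vertical_killing C ln Rinv HC Z1 Z3 Z2 smooth_ln is_derive_ln).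
      intros x Hx. replace (C I1 I1 I1 - 2 * C I1 I2 I2) with (- (1)) by (unfold s in S0; lra).
      auto_derive; [lra | field; lra]. }
    assert (L := ln_lt_2). rewrite ln_1 in E1. lra.
  - apply (Rpower_2_neq_1 s S0).
    transitivity (Rpower 1 s); [|unfold Rpower; rewrite ln_1, Rmult_0_r; exact exp_0].
    symmetry. apply (dim2_no_vertical_killing C (fun x => Rpower x s) H).
    apply (vertical_killing C _ (fun x => s * Rpower x (s - 1)) HC Z1 Z3 Z2 (smooth_Rpower s)).
    + intros x Hx. exact (is_derive_Rpower x s Hx).
    + intros x Hx.
      replace ((C I1 I1 I1 - 2 * C I1 I2 I2) * / x * (s * Rpower x (s - 1)))
        with (s * ((s - 1) * Rpower x (s - 1 - 1))).
      * apply is_derive_scal. apply is_derive_Rpower, Hx.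
      * replace (Rpower x (s - 1 - 1)) with (/ x * Rpower x (s - 1)).
        -- unfold s. ring.
        -- unfold Rminus at 2. rewrite Rpower_plus, Rpower_Ropp, Rpower_1 by exact Hx. ring.
Qed.

Lemma dim2_spf_isomorphic C : (forall i j k, C i j k = C j i k) ->
  has_dim half_plane (affine_killing half_plane (typeB C)) 2 ->
  strongly_proj_flat half_plane (typeB C) ->
  exists m e : R, m <> -1 /\ m <> 0 /\ (e = 1 \/ e = -1) /\
    linearly_isomorphic (typeB C) (typeB (modelC m e)).
Proof.
  intros HC HD HF.
  destruct (strongly_proj_flat_codazzi C HC HF) as (HS & HN).
  assert (H0 : C I2 I2 I1 <> 0).
  { intro Z. destruct (codazzi_C221_zero C HC HS HN Z) as (Z1 & Z2).
    exact (dim2_C221_neq0 C HC HD Z1 Z2 Z). }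
  destruct (codazzi_normal_form C HC HS HN H0) as (m & s & E1 & E2 & E3 & E4 & E5).
  (* The rescaling that makes C_22^1 a sign. *)
  set (b := sqrt (Rabs (C I2 I2 I1))).
  assert (Pb : 0 < Rabs (C I2 I2 I1)) by (apply Rabs_pos_lt, H0).
  assert (Hb : b * b = Rabs (C I2 I2 I1)) by (apply sqrt_sqrt; lra).
  assert (Nb : b <> 0) by (intro Z; rewrite Z in Hb; lra).
  assert (He : exists e, (e = 1 \/ e = -1) /\ C I2 I2 I1 = e * (b * b)).
  { rewrite Hb. destruct (Rle_dec 0 (C I2 I2 I1)) as [P | P].
    - exists 1. split; [tauto|]. rewrite Rabs_pos_eq by exact P. ring.
    - exists (-1). split; [tauto|]. rewrite Rabs_left by lra. ring. }
  destruct He as (e & He & Ee). exists m, e. split; [|split; [|split]].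
  - intros ->.
    destruct (dim2_killing_dependent C _ HD
      (hyperbolic_model_killing C s HC H0 ltac:(lra) E2 E3 ltac:(lra) E5))
      as (p & q & r & N & D1 & D2). cbv beta iota in D1, D2.
    assert (A := D1 1 0 Rlt_0_1). assert (B := D1 1 1 Rlt_0_1).
    assert (R0 : r = 0) by lra. subst r.
    assert (D := D2 1 0 Rlt_0_1). apply N. repeat split; lra.
  - intros ->.
    destruct (dim2_killing_dependent C _ HD
      (flat_model_killing C s HC ltac:(lra) E2 E3 ltac:(lra) E5))
      as (p & q & r & N & D1 & D2). cbv beta iota in D1, D2.
    assert (A := D1 1 0 Rlt_0_1). assert (B := D1 2 0 Rlt_0_2).
    assert (D := D2 1 0 Rlt_0_1). rewrite Rinv_1 in A.
    assert (R0 : r = 0) by lra. subst r. apply N. repeat split; lra.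
  - exact He.
  - apply linearly_isomorphic_conjugate. exists (s * b), b. split; [exact Nb|].
    apply conjugate_normal_form; assumption.
Qed.

(** Subtracting w = d (c log x) from the normal form leaves the constants
    C_11^1 = 1, C_22^1 = e of a flat connection; w is invariant under the linear
    isomorphism because that preserves x. *)
Lemma conjugate_model_spf C c e a b : b <> 0 -> conjugate a b C (modelC c e) ->
  strongly_proj_flat half_plane (typeB C).
Proof.
  intros Hb HC.
  set (C0 := fun i j k => C i j k - c * (delta I1 i * delta j k + delta I1 j * delta i k)).
  set (w := fun i : idx => fun x (_ : R) => c * delta I1 i * / x).
  assert (A1 : forall i j, C i j I1 =
    sum_idx (fun k => sum_idx (fun m => jac a b i k * jac a b j m * modelC c e k m I1))).
  { intros i j. rewrite <- (HC i j I1). unfold sum_idx. simpl. ring. }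
  assert (A2 : forall i j, C i j I2 =
    / b * (sum_idx (fun k => sum_idx (fun m => jac a b i k * jac a b j m * modelC c e k m I2))
           - a * C i j I1)).
  { intros i j. rewrite <- (HC i j I2). unfold sum_idx. simpl. field. exact Hb. }
  intros p Hp. exists half_plane, (typeB C0), w.
  split; [exact open_half_plane|]. split; [exact Hp|]. split; [tauto|].
  split; [apply smooth_typeB|]. split; [|split; [|split]].
  - intros i j k x y _. unfold typeB, C0. f_equal.
    destruct k; rewrite ?A2, !A1; unfold sum_idx; destruct i, j; simpl; ring.
  - apply flat_of_riemann; [exact open_half_plane | apply smooth_typeB|].
    intros i j l k x y Hx. rewrite riemann_typeB by exact Hx.
    replace (riemann_coeff C0 i j l k) with 0; [ring|].
    unfold riemann_coeff, C0, sum_idx. rewrite ?A2, !A1. unfold sum_idx.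
    destruct i, j, l, k; simpl; rewrite ?A2, ?A1; unfold sum_idx; simpl; field; exact Hb.
  - split.
    + intro i. unfold w. smoothness.
    + intros x y Hx. unfold w, pd. simpl. rewrite Derive_const.
      replace (fun t => c * 0 * / t) with (fun _ : R => 0)
        by (apply functional_extensionality; intro; ring).
      apply Derive_const.
  - intros X Y _ _ x y Hx k. unfold vadd, vscale, pairing, nabla, typeB, C0, w, sum_idx.
    destruct k; simpl; ring.
Qed.

(** * The solution spaces E(mu) of the models *)

(** The components of H f = mu f rho_s for the model; those with indices 12 and 21
    coincide. *)
Definition model_equations (c e mu : R) (f : sfun) : Prop := forall x y, 0 < x ->
  pd I1 (pd I1 f) x y = (1 + 2 * c) * / x * pd I1 f x y + mu * c * (2 + c) * (/ x * / x) * f x y /\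
  pd I1 (pd I2 f) x y = c * / x * pd I2 f x y /\
  pd I2 (pd I2 f) x y = e * / x * pd I1 f x y + mu * e * c * (/ x * / x) * f x y.

Lemma E_model_iff c e mu f : E half_plane mu (typeB (modelC c e)) f <->
  smooth half_plane f /\ model_equations c e mu f.
Proof.
  unfold E, hessian, ricci_sym, sum_idx. split; intros (Sf & H); (split; [exact Sf|]).
  - intros x y Hx.
    assert (H11 := H I1 I1 x y Hx). assert (H12 := H I1 I2 x y Hx).
    assert (H22 := H I2 I2 x y Hx).
    rewrite !ricci_model in H11 by exact Hx. rewrite !ricci_model in H12 by exact Hx.
    rewrite !ricci_model in H22 by exact Hx.
    unfold typeB, modelC in H11, H12, H22. split; [|split]; lra.
  - intros i j x y Hx. destruct (H x y Hx) as (H11 & H12 & H22).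
    assert (H21 : pd I2 (pd I1 f) x y = c * / x * pd I2 f x y).
    { rewrite (pd_comm half_plane f x y open_half_plane Sf Hx). exact H12. }
    rewrite !ricci_model by exact Hx. unfold typeB.
    destruct i, j; [rewrite H11 | rewrite H12 | rewrite H21 | rewrite H22];
      unfold modelC; lra.
Qed.

Lemma E_ext mu G f g : (forall x y, 0 < x -> f x y = g x y) ->
  E half_plane mu G f -> E half_plane mu G g.
Proof.
  intros H (Sf & Hf). split; [exact (smooth_ext half_plane f g open_half_plane H Sf)|].
  assert (P : forall i x y, 0 < x -> pd i f x y = pd i g x y).
  { intros i x y Hx. exact (pd_ext half_plane f g i x y open_half_plane Hx H). }
  intros i j x y Hx. rewrite <- H by exact Hx. rewrite <- Hf by exact Hx.
  unfold hessian, sum_idx. rewrite !P by exact Hx.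
  rewrite (pd_ext half_plane _ _ i x y open_half_plane Hx (P j)). reflexivity.
Qed.

Lemma pd_weight1 k g i x y : smooth half_plane g -> 0 < x ->
  pd i (fun x y => k * / x * g x y) x y =
  k * / x * (pd i g x y - delta I1 i * / x * g x y).
Proof.
  intros Sg Hx.
  repeat rewrite (pd_mult half_plane); try exact Hx; smoothness.
  rewrite pd_const, pd_inv by exact Hx. ring.
Qed.

Lemma pd_weight2 k g i x y : smooth half_plane g -> 0 < x ->
  pd i (fun x y => k * (/ x * / x) * g x y) x y =
  k * (/ x * / x) * (pd i g x y - 2 * delta I1 i * / x * g x y).
Proof.
  intros Sg Hx.
  repeat rewrite (pd_mult half_plane); try exact Hx; smoothness.
  rewrite pd_const, !pd_inv by exact Hx. ring.
Qed.

(** The derivative h = d_2 f satisfies d_1 h = (c/x) h and d_2^2 h = (K/x^2) h with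
    K = e c (1 + mu). By the first equation d_2^2 h also grows like x^c, by the
    second like x^(c-2); hence K h = 0. *)
Lemma model_solution_pd2 c e mu f : c <> 0 -> e <> 0 -> mu <> -1 ->
  smooth half_plane f -> model_equations c e mu f ->
  forall x y, 0 < x -> pd I2 f x y = 0.
Proof.
  intros Hc He Hmu Sf H.
  assert (OH := open_half_plane).
  set (K := e * c * (1 + mu)).
  assert (HK : K <> 0).
  { unfold K. apply Rmult_integral_contrapositive. split; [|lra].
    apply Rmult_integral_contrapositive. split; assumption. }
  set (h := pd I2 f).
  assert (Sh : smooth half_plane h) by (apply smooth_pd, Sf).
  assert (H1 : forall x y, 0 < x -> pd I1 h x y = c * / x * h x y).
  { intros x y Hx. apply (H x y Hx). }
  assert (H22 : forall x y, 0 < x -> pd I2 (pd I2 h) x y = K * (/ x * / x) * h x y).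
  { intros x y Hx.
    rewrite (pd_ext half_plane (pd I2 h) (fun x y => e * / x * pd I1 f x y
               + mu * e * c * (/ x * / x) * f x y) I2 x y OH Hx)
      by (intros u v Hu; apply (H u v Hu)).
    rewrite (pd_plus half_plane); try exact Hx; smoothness.
    rewrite pd_weight1, pd_weight2 by first [exact Hx | smoothness].
    rewrite (pd_comm half_plane f x y OH Sf Hx).
    fold h. rewrite H1 by exact Hx. unfold K. simpl. ring. }
  assert (H12 : forall x y, 0 < x -> pd I1 (pd I2 h) x y = c * / x * pd I2 h x y).
  { intros x y Hx. rewrite <- (pd_comm half_plane h x y OH Sh Hx).
    rewrite (pd_ext half_plane _ (fun x y => c * / x * h x y) I2 x y OH Hx H1).
    rewrite pd_weight1 by first [exact Hx | smoothness]. simpl. ring. }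
  intros x y Hx.
  assert (L : pd I1 (pd I2 (pd I2 h)) x y = c * / x * (K * (/ x * / x) * h x y)).
  { rewrite <- (pd_comm half_plane (pd I2 h) x y OH (smooth_pd _ _ _ Sh) Hx).
    rewrite (pd_ext half_plane _ (fun x y => c * / x * pd I2 h x y) I2 x y OH Hx H12).
    rewrite pd_weight1, H22 by first [exact Hx | smoothness]. simpl. ring. }
  rewrite (pd_ext half_plane _ (fun x y => K * (/ x * / x) * h x y) I1 x y OH Hx H22) in L.
  rewrite pd_weight2, H1 in L by assumption. unfold delta in L.
  clearbody K.
  assert (Z : (K * (/ x * / x * / x)) * h x y = 0) by lra.
  destruct (Rmult_integral _ _ Z) as [Z' | Z']; [exfalso; revert Z' | exact Z'].
  assert (/ x <> 0) by (apply Rinv_neq_0_compat; lra).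
  repeat apply Rmult_integral_contrapositive_currified; assumption.
Qed.

(** The equation for d_2^2 f loses its left-hand side. *)
Lemma model_solution_pd1 c e mu f : e <> 0 ->
  smooth half_plane f -> model_equations c e mu f ->
  (forall x y, 0 < x -> pd I2 f x y = 0) ->
  forall x y, 0 < x -> pd I1 f x y = - (mu * c) * / x * f x y.
Proof.
  intros He Sf H H2 x y Hx. destruct (H x y Hx) as (_ & _ & H22).
  rewrite (pd_ext half_plane _ (fun _ _ => 0) I2 x y open_half_plane Hx H2) in H22.
  rewrite pd_const in H22.
  assert (Hix : / x <> 0) by (apply Rinv_neq_0_compat; lra).
  apply (Rmult_eq_reg_l (e * / x)); [|apply Rmult_integral_contrapositive_currified; assumption].
  lra.
Qed.

Lemma E_model_zero c e f : c <> 0 -> e <> 0 ->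
  E half_plane 0 (typeB (modelC c e)) f <-> exists a, forall x y, 0 < x -> f x y = a.
Proof.
  intros Hc He. rewrite E_model_iff. split.
  - intros (Sf & H).
    assert (H2 := model_solution_pd2 c e 0 f Hc He ltac:(lra) Sf H).
    apply smooth_half_plane_const; [exact Sf|]. intros [|] x y Hx; [|exact (H2 x y Hx)].
    rewrite (model_solution_pd1 c e 0 f He Sf H H2 x y Hx). ring.
  - intros (a & Ha). apply E_model_iff. apply (E_ext _ _ (fun _ _ => a)).
    { intros x y Hx. symmetry. exact (Ha x y Hx). }
    apply E_model_iff. split; [exact (smooth_const _ a open_half_plane)|].
    assert (P : forall i x y, 0 < x -> pd i (fun _ _ => a) x y = 0).
    { intros. apply pd_const. }
    intros x y Hx.
    rewrite !(pd_ext half_plane _ (fun _ _ => 0) _ x y open_half_plane Hx (P _)).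
    rewrite !pd_const. repeat split; ring.
Qed.

Lemma E_model_other c e mu f : c <> 0 -> e <> 0 -> mu <> 0 -> mu <> -1 ->
  E half_plane mu (typeB (modelC c e)) f <-> forall x y, 0 < x -> f x y = 0.
Proof.
  intros Hc He H0 Hm. rewrite E_model_iff. split.
  - intros (Sf & H) x y Hx.
    assert (H2 := model_solution_pd2 c e mu f Hc He Hm Sf H).
    assert (H1 := model_solution_pd1 c e mu f He Sf H H2).
    destruct (H x y Hx) as (H11 & _ & _).
    rewrite (pd_ext half_plane _ (fun x y => - (mu * c) * / x * f x y) I1 x y
               open_half_plane Hx H1) in H11.
    rewrite pd_weight1, H1 in H11 by assumption. unfold delta in H11.
    assert (Z : (mu * (c * (c * ((mu + 1) * (/ x * / x))))) * f x y = 0) by lra.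
    destruct (Rmult_integral _ _ Z) as [Z' | Z']; [exfalso; revert Z' | exact Z'].
    assert (/ x <> 0) by (apply Rinv_neq_0_compat; lra).
    repeat apply Rmult_integral_contrapositive_currified; try assumption; lra.
  - intros H. apply E_model_iff. apply (E_ext _ _ (fun _ _ => 0)).
    { intros x y Hx. symmetry. exact (H x y Hx). }
    apply E_model_iff. split; [exact (smooth_const _ 0 open_half_plane)|].
    assert (P : forall i x y, 0 < x -> pd i (fun _ _ => 0) x y = 0).
    { intros. apply pd_const. }
    intros x y Hx.
    rewrite !(pd_ext half_plane _ (fun _ _ => 0) _ x y open_half_plane Hx (P _)).
    rewrite !pd_const. repeat split; ring.
Qed.

(** The equations for mu = -1 and varying c are carried into each other by powers
    of x; for c = 0 they say that f is affine for the flat connection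
    projectively related to all these models. *)
Lemma model_equations_Rpower c s e f : smooth half_plane f ->
  model_equations c e (-1) f ->
  model_equations (c + s) e (-1) (fun x y => Rpower x s * f x y).
Proof.
  intros Sf H.
  assert (P : forall i x y, 0 < x -> pd i (fun x y => Rpower x s * f x y) x y
    = Rpower x s * (pd i f x y + s * delta I1 i * / x * f x y)).
  { intros i x y Hx. rewrite (pd_mult half_plane); try exact Hx; smoothness.
    rewrite pd_Rpower by exact Hx. ring. }
  intros x y Hx.
  assert (PP : forall i j,
    pd i (pd j (fun x y => Rpower x s * f x y)) x y
    = Rpower x s * (pd i (pd j f) x y
        + s * delta I1 j * / x * (pd i f x y - delta I1 i * / x * f x y)
        + s * delta I1 i * / x * (pd j f x y + s * delta I1 j * / x * f x y))).
  { intros i j.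
    rewrite (pd_ext half_plane _ _ i x y open_half_plane Hx (P j)).
    rewrite (pd_mult half_plane); try exact Hx; smoothness.
    rewrite (pd_plus half_plane); try exact Hx; smoothness.
    rewrite pd_weight1, pd_Rpower by assumption. ring. }
  rewrite !PP, !P by exact Hx.
  destruct (H x y Hx) as (-> & -> & ->). unfold delta. repeat split; ring.
Qed.

(** The equations are those of an affine function: they make (d_1 g)/x a constant A,
    then d_2 g - e A y a constant, then g up to a constant. *)
Lemma flat_affine_functions e g : smooth half_plane g -> model_equations 0 e (-1) g ->
  exists a0 a1 a2, forall x y, 0 < x ->
    g x y = a0 + a1 * y + a2 * (x ^ 2 + e * y ^ 2).
Proof.
  intros Sg H. assert (OH := open_half_plane).
  destruct (smooth_half_plane_const (fun x y => / x * pd I1 g x y)) as (A & HA).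
  { smoothness. }
  { intros i x y Hx. rewrite (pd_mult half_plane); try exact Hx; smoothness.
    rewrite pd_inv by exact Hx. destruct (H x y Hx) as (H11 & H12 & _). destruct i.
    - rewrite H11. simpl. ring.
    - rewrite (pd_comm half_plane g x y OH Sg Hx), H12. simpl. ring. }
  assert (H1 : forall x y, 0 < x -> pd I1 g x y = A * x).
  { intros x y Hx. rewrite <- (HA x y Hx). field. lra. }
  destruct (smooth_half_plane_const (fun x y => pd I2 g x y - e * A * y)) as (a1 & Ha1).
  { smoothness. }
  { intros i x y Hx.
    rewrite (pd_minus half_plane), (pd_mult half_plane (fun _ _ => e * A) (fun _ y => y));
      try exact Hx; smoothness.
    rewrite pd_const, pd_y. destruct (H x y Hx) as (_ & H12 & H22). destruct i.
    - rewrite H12. simpl. ring.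
    - rewrite H22, H1 by exact Hx. simpl. field. lra. }
  destruct (smooth_half_plane_const
    (fun x y => g x y - (a1 * y + A / 2 * (x * x + e * (y * y))))) as (a0 & Ha0).
  { smoothness. }
  { intros i x y Hx.
    repeat first [ rewrite (pd_minus half_plane) | rewrite (pd_plus half_plane)
                 | rewrite (pd_mult half_plane) ]; try exact Hx; smoothness.
    rewrite !pd_const, !pd_x, !pd_y. destruct i.
    - rewrite H1 by exact Hx. simpl. field.
    - assert (Q := Ha1 x y Hx). simpl. simpl in Q. lra. }
  exists a0, a1, (A / 2). intros x y Hx. rewrite <- (Ha0 x y Hx). ring.
Qed.

Lemma flat_affine_functions_equations e a0 a1 a2 :
  model_equations 0 e (-1) (fun x y => a0 + a1 * y + a2 * (x ^ 2 + e * y ^ 2)).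
Proof.
  assert (P : forall i x y, 0 < x ->
    pd i (fun x y => a0 + a1 * y + a2 * (x ^ 2 + e * y ^ 2)) x y
    = match i with I1 => 2 * a2 * x | I2 => a1 + 2 * a2 * e * y end).
  { intros [|] x y Hx; explicit_pd. }
  assert (PP : forall i j x y, 0 < x ->
    pd i (pd j (fun x y => a0 + a1 * y + a2 * (x ^ 2 + e * y ^ 2))) x y
    = match i, j with I1, I1 => 2 * a2 | I2, I2 => 2 * a2 * e | _, _ => 0 end).
  { intros i j x y Hx. rewrite (pd_ext half_plane _ _ i x y open_half_plane Hx (P j)).
    destruct i, j; explicit_pd. }
  intros x y Hx. rewrite !PP, !P by exact Hx. repeat split; field; lra.
Qed.

Lemma E_model_minus_one c e f :
  E half_plane (-1) (typeB (modelC c e)) f <->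
  exists a0 a1 a2, forall x y, 0 < x ->
    f x y = Rpower x c * (a0 + a1 * y + a2 * (x ^ 2 + e * y ^ 2)).
Proof.
  split.
  - intros HE. apply E_model_iff in HE. destruct HE as (Sf & H).
    apply (model_equations_Rpower c (- c) e f Sf) in H. rewrite Rplus_opp_r in H.
    assert (Sg : smooth half_plane (fun x y => Rpower x (- c) * f x y)) by smoothness.
    destruct (flat_affine_functions e _ Sg H) as (a0 & a1 & a2 & Ha).
    exists a0, a1, a2. intros x y Hx. rewrite <- (Ha x y Hx).
    rewrite <- Rmult_assoc, <- Rpower_plus, Rplus_opp_r, Rpower_O by exact Hx. ring.
  - intros (a0 & a1 & a2 & Ha).
    set (g := fun x y => a0 + a1 * y + a2 * (x ^ 2 + e * y ^ 2)).
    assert (Sg : smooth half_plane g) by (unfold g; simpl; smoothness).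
    apply (E_ext _ _ (fun x y => Rpower x c * g x y)).
    { intros x y Hx. symmetry. exact (Ha x y Hx). }
    apply E_model_iff. split; [smoothness|].
    assert (H := model_equations_Rpower 0 c e g Sg (flat_affine_functions_equations e a0 a1 a2)).
    rewrite Rplus_0_l in H. exact H.
Qed.

Theorem theorem5p7 :
  (forall C : idx -> idx -> idx -> R,
     (forall i j k, C i j k = C j i k) ->
     has_dim half_plane (affine_killing half_plane (typeB C)) 2 ->
     (strongly_proj_flat half_plane (typeB C) <->
      exists c e : R, c <> -1 /\ c <> 0 /\ (e = 1 \/ e = -1) /\
        linearly_isomorphic (typeB C) (typeB (modelC c e)))) /\
  (forall c e : R, c <> -1 -> c <> 0 -> (e = 1 \/ e = -1) ->
     (forall x y, 0 < x ->
        ricci (typeB (modelC c e)) (frame I1) (frame I1) x y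
          = / x ^ 2 * (c * (2 + c)) /\
        ricci (typeB (modelC c e)) (frame I1) (frame I2) x y = 0 /\
        ricci (typeB (modelC c e)) (frame I2) (frame I1) x y = 0 /\
        ricci (typeB (modelC c e)) (frame I2) (frame I2) x y
          = / x ^ 2 * (e * c)) /\
     (forall f, E half_plane 0 (typeB (modelC c e)) f <->
        exists a : R, forall x y, 0 < x -> f x y = a) /\
     (forall f, E half_plane (-1) (typeB (modelC c e)) f <->
        exists a0 a1 a2 : R, forall x y, 0 < x ->
          f x y = Rpower x c * (a0 + a1 * y + a2 * (x ^ 2 + e * y ^ 2))) /\
     (forall mu : R, mu <> 0 -> mu <> -1 ->
        forall f, E half_plane mu (typeB (modelC c e)) f <->
          forall x y, 0 < x -> f x y = 0)).
Proof.
  split.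
  - intros C HC HD. split.
    + exact (dim2_spf_isomorphic C HC HD).
    + intros (c & e & _ & _ & _ & HI). apply linearly_isomorphic_conjugate in HI.
      destruct HI as (a & b & Hb & H). exact (conjugate_model_spf C c e a b Hb H).
  - intros c e _ Hc He. assert (He0 : e <> 0) by (destruct He; lra).
    split; [|split; [|split]].
    + intros x y Hx. rewrite !ricci_model by exact Hx. repeat split; field; lra.
    + intro f. exact (E_model_zero c e f Hc He0).
    + exact (E_model_minus_one c e).
    + intros mu H0 H1 f. exact (E_model_other c e mu f Hc He0 H0 H1).
Qed.
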